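(* There is an algorithm which, given a lattice polygon $P\subset\mathbb{R}^2$ (possibly 1-dimensional), computes the full Minkowski length $L(P)$ in time polynomial in $|P\cap\mathbb{Z}^2|$, the number of lattice points in $P$.
   Context: A lattice polytope in $\mathbb{R}^2$ is the convex hull of a nonempty finite subset of $\mathbb{Z}^2$. The Minkowski sum is $P+Q=\{p+q : p\in P,q\in Q\}$. For a lattice polytope $Q$, the Minkowski length $\ell(Q)$ is the largest number of summands in a decomposition $Q=Q_1+\dots+Q_\ell$ into lattice polytopes of positive dimension ($0$ if $Q$ is a point). The full Minkowski length of $P$ is $L(P)=\max\{\ell(Q) : Q\subseteq P\text{ a lattice polytope}\}$. The polygon may be taken to be given by the list of its lattice points, and running time is measured by the number of elementary operations (arithmetic and comparisons) on integers. *)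

(* Defs.v *)
From mathcomp Require Import all_boot all_order all_algebra.
From mathcomp Require Import boolp classical_sets cardinality reals convex.
Set Implicit Arguments.
Unset Strict Implicit.
Unset Printing Implicit Defensive.
Import Order.TTheory GRing.Theory Num.Theory.
Local Open Scope classical_set_scope.
Local Open Scope ring_scope.

Definition lattice_point (R : realType) (z : 'rV[int]_2) : 'rV[R]_2 :=
  map_mx intr z.

Definition convex_hull (R : realType) (A : set 'rV[R]_2) : set 'rV[R]_2 :=
  smallest (@convex_set R 'rV[R]_2) A.

Definition lattice_polytope (R : realType) (P : set 'rV[R]_2) : Prop :=
  exists A : set 'rV[int]_2,
    [/\ finite_set A, A !=set0 & P = convex_hull (@lattice_point R @` A)].

Definition positive_dim (R : realType) (P : set 'rV[R]_2) : Prop :=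
  exists x y, [/\ P x, P y & x <> y].

Definition minkowski_sum (R : realType) (P Q : set 'rV[R]_2) : set 'rV[R]_2 :=
  [set p + q | p in P & q in Q].

Definition minkowski_decomposition (R : realType) (Q : set 'rV[R]_2)
    (Qs : seq (set 'rV[R]_2)) : Prop :=
  (forall i, (i < size Qs)%N ->
     lattice_polytope (nth set0 Qs i) /\ positive_dim (nth set0 Qs i)) /\
  Q = foldr (@minkowski_sum R) [set 0] Qs.

Definition is_max (S : set nat) (m : nat) : Prop :=
  S m /\ forall k, S k -> (k <= m)%N.

(* The lengths are given as relations: asserting them of some number includes
   the existence of the maximum. *)
Definition is_minkowski_length (R : realType) (Q : set 'rV[R]_2) (l : nat) :
    Prop :=
  (positive_dim Q ->
     is_max [set k | exists2 Qs, minkowski_decomposition Q Qs & size Qs = k] l)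
  /\ (~ positive_dim Q -> l = 0%N).

Definition is_full_minkowski_length (R : realType) (P : set 'rV[R]_2)
    (L : nat) : Prop :=
  is_max [set l | exists Q, [/\ lattice_polytope Q, Q `<=` P
                              & is_minkowski_length Q l]] L.

(* Algorithms are programs of a unit-cost random access machine over the
   integers, with registers indexed by nat and an integer-addressed memory. *)
Inductive binop : Type :=
  | OpAdd | OpSub | OpMul | OpDiv | OpMod | OpEq | OpLe.

Inductive expr : Type :=
  | Const of int
  | Reg of nat
  | Fetch of expr
  | Binop of binop & expr & expr.

Inductive program : Type :=
  | Skip
  | Assign of nat & expr
  | Store of expr & expr
  | Seq of program & program
  | If of expr & program & program
  | While of expr & program.

Record state : Type := State { regs : nat -> int; memory : int -> int }.

Definition update (K : eqType) (f : K -> int) (k : K) (v : int) : K -> int :=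
  fun j => if j == k then v else f j.

Definition eval_binop (o : binop) (x y : int) : int :=
  match o with
  | OpAdd => x + y
  | OpSub => x - y
  | OpMul => x * y
  | OpDiv => (x %/ y)%Z
  | OpMod => (x %% y)%Z
  | OpEq => (nat_of_bool (x == y))%:Z
  | OpLe => (nat_of_bool (x <= y))%:Z
  end.

Fixpoint eval (st : state) (e : expr) : int :=
  match e with
  | Const z => z
  | Reg r => regs st r
  | Fetch a => memory st (eval st a)
  | Binop o e1 e2 => eval_binop o (eval st e1) (eval st e2)
  end.

Fixpoint cost (e : expr) : nat :=
  match e with
  | Const _ | Reg _ => 1
  | Fetch a => (cost a).+1
  | Binop _ e1 e2 => (cost e1 + cost e2).+1
  end.

(* [exec c st t st']: started in st, the program c halts in st' after exactly
   t elementary operations. A test succeeds when its value is nonzero. *)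
Inductive exec : program -> state -> nat -> state -> Prop :=
  | exec_skip st : exec Skip st 1 st
  | exec_assign r e st :
      exec (Assign r e) st (cost e).+1
        (State (update (regs st) r (eval st e)) (memory st))
  | exec_store a e st :
      exec (Store a e) st (cost a + cost e).+1
        (State (regs st) (update (memory st) (eval st a) (eval st e)))
  | exec_seq c1 c2 st st1 st2 t1 t2 :
      exec c1 st t1 st1 -> exec c2 st1 t2 st2 ->
      exec (Seq c1 c2) st (t1 + t2) st2
  | exec_if_true e c1 c2 st st1 t :
      eval st e != 0 -> exec c1 st t st1 ->
      exec (If e c1 c2) st (cost e + t).+1 st1
  | exec_if_false e c1 c2 st st1 t :
      eval st e = 0 -> exec c2 st t st1 ->
      exec (If e c1 c2) st (cost e + t).+1 st1
  | exec_while_true e c st st1 st2 t1 t2 :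
      eval st e != 0 -> exec c st t1 st1 -> exec (While e c) st1 t2 st2 ->
      exec (While e c) st (cost e + t1 + t2).+1 st2
  | exec_while_false e c st :
      eval st e = 0 -> exec (While e c) st (cost e).+1 st.

(* A list of n points is given by n in register 0 and the coordinates
   x_0, y_0, x_1, y_1, ... at the addresses 0, 1, 2, 3, ...; all the other
   registers and cells hold 0. *)
Definition input_state (s : seq 'rV[int]_2) : state :=
  State (update (fun=> 0) 0%N (size s)%:Z)
    (fun a => if a is Posz k then
                nth 0 (flatten [seq [:: z 0 0; z 0 1] | z : 'rV[int]_2 <- s]) k
              else 0).

Definition outputs_in (c : program) (s : seq 'rV[int]_2) (t v : nat) : Prop :=
  exists2 st, exec c (input_state s) t st & regs st 0%N = v%:Z.

Definition lists_lattice_points (R : realType) (P : set 'rV[R]_2)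
    (s : seq 'rV[int]_2) : Prop :=
  uniq s /\ forall z, z \in s <-> P (lattice_point R z).

(* Main.v *)
(* A Minkowski sum of k segments in P is a base point z with k nonzero lattice
   vectors all of whose subset sums, shifted by z, lie in P. If two different
   vectors a, b of such a family, oriented to be lexicographically positive, are
   congruent mod 2, both can be replaced by the midpoint (a + b) / 2, and
   |a|^2 + |b|^2 drops. So some family with the same k has at most one vector
   per class mod 2: it consists of four vectors with multiplicities, the latter
   being less than n = |P /\ Z^2|. By convexity the sum lies in P iff its 16
   corners do. The program runs through all guesses for the positions, in the
   list of lattice points, of z, of the tips of the four vectors and of the 16
   corners, and for the four multiplicities; a guess is encoded by the 25 digits
   in base n of the loop counter, so that checking it needs no inner loop. *)
Require Import Defs.
From mathcomp Require Import all_boot all_order all_algebra.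
From mathcomp Require Import zify ring lra.
From mathcomp Require Import boolp classical_sets cardinality reals convex.
From mathcomp Require Import interval_inference.
Set Implicit Arguments.
Unset Strict Implicit.
Unset Printing Implicit Defensive.
Import Order.TTheory GRing.Theory Num.Theory.
Local Open Scope ring_scope.

(** * Families of vectors whose shifted subset sums stay in a given set *)

Section SubsetSums.
Variables (V : zmodType).
Implicit Types (S : V -> Prop) (x y z a v : V) (vs : seq V).

(** Each vector is either skipped or added to the base point, so repeated vectors count separately,
    and inductions on the list generalise over [z]. *)
Fixpoint subset_sums_in S z vs : Prop :=
  if vs is v :: vs' then subset_sums_in S z vs' /\ subset_sums_in S (z + v) vs'
  else S z.

(** The trace of convexity on a lattice; the combinatorial part uses no other geometric property of
    the polygon. *)
Definition segment_closed S : Prop :=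
  forall x a m k, (k <= m)%N -> S x -> S (x + a *+ m) -> S (x + a *+ k).

Lemma subset_sums_in_front S z u v w :
  subset_sums_in S z (u ++ v :: w) -> subset_sums_in S z (v :: u ++ w).
Proof.
elim: u z => [//|x u IH] z /= [/IH [? ?] /IH [? ?]]; split; split=> //.
by rewrite addrAC.
Qed.

Lemma subset_sums_in_shift S (S' : V -> Prop) d z vs :
  (forall x, S x -> S' (d + x)) ->
  subset_sums_in S z vs -> subset_sums_in S' (d + z) vs.
Proof.
move=> SS'; elim: vs z => [|v vs IH] z /=; first exact: SS'.
by move=> [/IH ? /IH ?]; rewrite -addrA.
Qed.

Lemma subset_sums_in_sub S (S' : V -> Prop) z vs :
  (forall x, S x -> S' x) -> subset_sums_in S z vs -> subset_sums_in S' z vs.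
Proof.
move=> SS'; rewrite -{2}[z]add0r; apply: subset_sums_in_shift => x /SS'.
by rewrite add0r.
Qed.

(** For fixed [vs] the admissible base points form an intersection of translates of [S], which
    inherits closure under segments. *)
Lemma subset_sums_in_segment S vs z a m k :
  segment_closed S -> (k <= m)%N -> subset_sums_in S z vs ->
  subset_sums_in S (z + a *+ m) vs -> subset_sums_in S (z + a *+ k) vs.
Proof.
move=> cS km; elim: vs z => [|v vs IH] z /=; first exact: cS.
move=> [h1 h2]; rewrite addrAC => -[h3 h4]; split; first exact: IH.
by rewrite addrAC; apply: IH.
Qed.

(** Every partial multiple of [a] lies on the segment from [0] to [a *+ m], so it is enough to
    control the two extremes. *)
Lemma subset_sums_in_nseq S z a m vs :
  segment_closed S -> subset_sums_in S z vs ->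
  subset_sums_in S (z + a *+ m) vs -> subset_sums_in S z (nseq m a ++ vs).
Proof.
move=> cS; elim: m z => [|m IH] z //= h0 h1; split.
  by apply: IH => //; apply: subset_sums_in_segment h1.
apply: IH; last by rewrite -addrA -mulrS.
by rewrite -[a]mulr1n; apply: subset_sums_in_segment h1.
Qed.

(** The corner criterion: each block of equal vectors need only be taken entirely or not at all. A
    bit mask [b] selects the blocks taken. *)
Lemma subset_sums_in_blocks (J : Type) S z (a : J -> V) (m : J -> nat) js :
  segment_closed S ->
  (forall b, S (z + \sum_(j <- mask b js) a j *+ m j)) ->
  subset_sums_in S z (flatten [seq nseq (m j) (a j) | j <- js]).
Proof.
move=> cS; elim: js z => [|j js IH] z h /=.
  by have := h [::]; rewrite big_nil addr0.
apply: subset_sums_in_nseq => //; apply: IH => b.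
  exact: (h (false :: b)).
by have := h (true :: b); rewrite /= big_cons addrA.
Qed.

Lemma subset_sums_in_filter S z vs (f : pred V) :
  subset_sums_in S z vs -> S (z + \sum_(v <- vs | f v) v).
Proof.
elim: vs z => [|v vs IH] z /=; first by rewrite big_nil addr0.
by rewrite big_cons; case: ifP => _ [h1 h2]; rewrite ?addrA; apply: IH.
Qed.

End SubsetSums.

(** * Reduction to at most one vector per class modulo 2 *)

Section ParityReduction.
Implicit Types (a b c d v z : 'rV[int]_2) (vs : seq 'rV[int]_2).

Definition parity v : bool * bool := (odd `|v 0 0|, odd `|v 0 1|).

Definition norm2 v : nat := `|v 0 0 ^+ 2 + v 0 1 ^+ 2|.

Definition lexpos v : bool := (0 < v 0 0) || (v 0 0 == 0) && (0 < v 0 1).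

(** Reduces equality of vectors to two integer equations, which the arithmetic tactics can
    handle. *)
Lemma row2P v b : v 0 0 = b 0 0 -> v 0 1 = b 0 1 -> v = b.
Proof.
move=> h0 h1; apply/rowP; case=> [[|[|//]] ?].
  by rewrite (_ : Ordinal _ = 0) //; apply: val_inj.
by rewrite (_ : Ordinal _ = 1) //; apply: val_inj.
Qed.

Lemma same_parity_half (x y : int) :
  odd `|x| = odd `|y| -> exists u w : int, x = u + w /\ y = u - w.
Proof. by move=> xy; exists ((x + y) %/ 2)%Z, ((x - y) %/ 2)%Z; lia. Qed.

(** Write [a = u + w] and [b = u - w] with [w] nonzero, and take [c = u]. By the parallelogram law
    the squared norms of [a] and [b] add up to twice those of [u] and [w]. The orientation excludes
    [b = - a], whose midpoint would vanish. *)
Lemma parity_midpoint a b :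
  parity a = parity b -> a != b -> lexpos a -> lexpos b ->
  exists c, [/\ a + b = c *+ 2, lexpos c
              & (norm2 c + norm2 c < norm2 a + norm2 b)%N].
Proof.
move=> [/same_parity_half[u0 [w0 [a0 b0]]] /same_parity_half[u1 [w1 [a1 b1]]]].
move=> ab a_gt0 b_gt0.
pose c : 'rV[int]_2 := \row_i (if i == 0 then u0 else u1).
have c0 : c 0 0 = u0 by rewrite mxE.
have c1 : c 0 1 = u1 by rewrite mxE.
exists c; split.
- by rewrite mulr2n; apply: row2P; rewrite !mxE /= ?a0 ?b0 ?a1 ?b1; ring.
- by move: a_gt0 b_gt0; rewrite /lexpos a0 a1 b0 b1 c0 c1; lia.
have w_neq0 : (0 < w0 ^+ 2 + w1 ^+ 2).
  rewrite lt_neqAle addr_ge0 ?sqr_ge0 // andbT eq_sym paddr_eq0 ?sqr_ge0 //.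
  rewrite !sqrf_eq0; apply: contra ab => /andP[/eqP w00 /eqP w10].
  by apply/eqP/row2P; rewrite ?a0 ?b0 ?a1 ?b1 ?w00 ?w10 ?addr0 ?subr0.
rewrite /norm2 c0 c1 a0 a1 b0 b1 -ltz_nat !PoszD.
rewrite !gez0_abs ?addr_ge0 ?sqr_ge0 //.
nra.
Qed.

Lemma lexpos_neq0 v : lexpos v -> v != 0.
Proof. by apply: contraTneq => ->; rewrite /lexpos !mxE ltxx. Qed.

Lemma lexposN v : v != 0 -> ~~ lexpos v -> lexpos (- v).
Proof.
move=> v0; rewrite /lexpos !mxE => h.
have : v 0 0 != 0 \/ v 0 1 != 0.
  have [h0|] := eqVneq (v 0 0) 0; last by left.
  right; apply: contra v0 => /eqP h1.
  by apply/eqP/row2P; rewrite mxE.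
by move: h; set x : int := v 0 0; set y : int := v 0 1; lia.
Qed.

(** Reversing a vector [v] and moving the base point by [v] leaves the set of subset sums
    unchanged. *)
Lemma subset_sums_in_orient S z vs :
  all (fun v => v != 0) vs -> subset_sums_in S z vs ->
  exists z' vs', [/\ size vs' = size vs, all lexpos vs'
                   & subset_sums_in S z' vs'].
Proof.
pose flip v := if lexpos v then v else - v.
pose shift v := if lexpos v then 0 else v.
move=> vs0 vsS; exists (z + \sum_(v <- vs) shift v), (map flip vs).
split; first by rewrite size_map.
  rewrite all_map; apply: sub_all vs0 => v v0 /=; rewrite /flip.
  by case: ifP => // /negbT; apply: lexposN.
elim: vs z vsS {vs0} => [|v vs IH] z /=; first by rewrite big_nil addr0.
move=> [/IH h1 /IH h2]; rewrite big_cons.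
have [[-> ->]|[-> ->]] :
    flip v = v /\ shift v = 0 \/ flip v = - v /\ shift v = v.
- by rewrite /flip /shift; case: ifP; [left|right].
- by rewrite add0r addrAC.
- by rewrite addrA; split; rewrite // addrAC addrK.
Qed.

Lemma subset_sums_in_reduce S z vs :
  segment_closed S -> all lexpos vs -> subset_sums_in S z vs ->
  exists ws, [/\ size ws = size vs, all lexpos ws, subset_sums_in S z ws
               & {in ws &, injective parity}].
Proof.
move=> cS.
(* Strong induction on the total squared norm, which each replacement by a midpoint lowers. *)
have [n] := ubnP (\sum_(v <- vs) norm2 v)%N.
elim: n vs => // n IH vs; rewrite ltnS => len vs_pos vsS.
have [inj|] := boolP (all (fun a => all (fun b => (parity a == parity b) ==>
                        (a == b)) vs) vs).
  exists vs; split=> // a b avs bvs /eqP pab.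
  by move/allP: inj => /(_ a avs) /allP/(_ b bvs) /implyP/(_ pab) /eqP.
case/allPn => a avs /allPn[b bvs]; rewrite negb_imply => /andP[/eqP pab ab].
case/splitPr: avs vs_pos vsS len bvs => u w.
move=> vs_pos /subset_sums_in_front vsS len bvs.
have {}bvs : b \in u ++ w.
  by move: bvs; rewrite !mem_cat inE [b == a]eq_sym (negPf ab).
have {}len : (norm2 a + \sum_(v <- u ++ w) norm2 v <= n)%N.
  by move: len; rewrite !big_cat big_cons /= addnCA.
have {}vs_pos : lexpos a && all lexpos (u ++ w).
  by move: vs_pos; rewrite !all_cat /= andbCA.
have -> : size (u ++ a :: w) = (size (u ++ w)).+1 by rewrite !size_cat addnS.
move: (u ++ w) bvs len vs_pos vsS => {u w} r br.
case/splitPr: br => u w; rewrite big_cat big_cons /= => len.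
rewrite all_cat /= => /and4P[a_pos u_pos b_pos w_pos] [].
move=> /subset_sums_in_front /= [h0 hb] /subset_sums_in_front /= [ha hab].
have [c [abc c_pos lec]] := parity_midpoint pab ab a_pos b_pos.
have {}hab : subset_sums_in S (z + c *+ 2) (u ++ w).
  by rewrite -abc addrA.
(* The base point [z + c] is halfway between [z] and [z + a + b], both of which are admissible for
   the remaining vectors. *)
have hc : subset_sums_in S (z + c) (u ++ w).
  by rewrite -[c]mulr1n; apply: subset_sums_in_segment hab.
have [|||ws [sz ws_pos wsS inj]] := IH (c :: c :: u ++ w).
- by rewrite !big_cons big_cat /=; lia.
- by rewrite /= c_pos all_cat u_pos.
- by rewrite /= -addrA -mulr2n.
by exists ws; split=> //; rewrite sz !size_cat /= !size_cat addnS.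
Qed.

End ParityReduction.

(** * Finite certificates for families of segments *)

Section Certificates.
Local Notation J := (bool * bool)%type.

(* A certificate assigns to each index a natural number: the positions in the
   list of points of the base point [None] and of the tips [Some j], the
   multiplicities [j], and the positions of the corners [A]. *)
Definition cert_index : finType := (option J + J + {set J})%type.
Definition point_of (o : option J) : cert_index := inl (inl o).
Definition mult_of (j : J) : cert_index := inl (inr j).
Definition corner_of (A : {set J}) : cert_index := inr A.

Variable s : seq 'rV[int]_2.
Implicit Types (d : cert_index -> nat).

(** A tip at the base point encodes the zero vector, so its multiplicity must not count. *)
Definition cert_value d : nat :=
  \sum_j d (mult_of j) * (d (point_of (Some j)) != d (point_of None)).

Definition cert_point d i : 'rV[int]_2 := nth 0 s (d i).

(** Since the positions of the corners are guessed too, membership of a corner in the list becomes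
    an equation between two points. *)
Definition cert_valid d : Prop :=
  forall A : {set J}, cert_point d (corner_of A) =
    cert_point d (point_of None) + \sum_(j in A)
      (cert_point d (point_of (Some j)) - cert_point d (point_of None))
        *+ d (mult_of j).

Hypothesis s_uniq : uniq s.
Hypothesis s_closed : segment_closed (fun x => x \in s).

(** The [m + 1] points [z + a *+ k] with [k <= m] are distinct members of [s]. This makes a
    multiplicity fit into one digit in base [size s]. *)
Lemma progression_lt_size z a m :
  a != 0 -> z \in s -> z + a *+ m \in s -> (m < size s)%N.
Proof.
move=> a_neq0 zs zms.
have inj : injective (fun k => z + a *+ k).
  have [i ai] : exists i, a 0 i != 0.
    apply/existsP; apply: contraNT a_neq0 => /existsPn a0.
    by apply/eqP/rowP => i; rewrite mxE; apply/eqP; have := a0 i; rewrite negbK.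
  move=> k l /addrI /(congr1 (fun v : 'rV_2 => v 0 i)).
  by rewrite !mulmxnE; apply: mulrIn.
rewrite -[m.+1](size_iota 0) -(size_map (fun k => z + a *+ k)).
apply: uniq_leq_size; first by rewrite map_inj_uniq ?iota_uniq.
move=> x /mapP[k]; rewrite mem_iota add0n ltnS => /andP[_ km] ->.
exact: (s_closed km).
Qed.

(** After orientation and reduction each parity class [j] holds copies of a single vector [a j], say
    [m j] of them; the sums over unions of classes are the corners. *)
Lemma cert_exists z vs :
  all (fun v => v != 0) vs -> subset_sums_in (fun x => x \in s) z vs ->
  exists d, [/\ forall i, (d i < size s)%N, cert_valid d
              & cert_value d = size vs].
Proof.
move=> vs0 /(subset_sums_in_orient vs0) [{}z [us [<- us_pos us_s]]].
have [ws [<- ws_pos ws_s inj]] := subset_sums_in_reduce s_closed us_pos us_s.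
move: ws ws_pos ws_s inj => {us us_pos us_s vs0} {}vs vs_pos vs_s inj.
pose m j := count (fun v => parity v == j) vs.
(* The default [0] is taken only for an empty class, where [m j] is 0. *)
pose a j := head 0 [seq v <- vs | parity v == j].
have aE v : v \in vs -> a (parity v) = v.
  move=> v_vs; rewrite /a.
  case E : [seq _ <- _ | _] => [|u r].
    have : v \in [seq u <- vs | parity u == parity v].
      by rewrite mem_filter eqxx.
    by rewrite E.
  have : u \in [seq u <- vs | parity u == parity v] by rewrite E mem_head.
  by rewrite mem_filter => /andP[/eqP uv u_vs] /=; apply: inj.
have sumE (A : {set J}) :
    \sum_(v <- vs | parity v \in A) v = \sum_(j in A) a j *+ m j.
  rewrite (partition_big parity (mem A)) //=; apply: eq_bigr => j jA.
  rewrite -iter_addr_0 -big_const_seq [LHS]big_seq_cond [RHS]big_seq_cond.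
  apply: eq_big => v; first by case: eqP => [->|_]; rewrite ?jA ?andbF.
  by move=> /and3P[v_vs _ /eqP <-]; rewrite aE.
have corner_s (A : {set J}) : z + \sum_(j in A) a j *+ m j \in s.
  by rewrite -sumE; apply: (subset_sums_in_filter _ vs_s).
have zs : z \in s.
  by have := corner_s finset.set0; rewrite finset.big_set0 addr0.
have am_s j : z + a j *+ m j \in s.
  by have := corner_s [set j]; rewrite finset.big_set1.
have a_neq0 j : (0 < m j)%N -> a j != 0.
  rewrite /m -has_count => /hasP[v v_vs /eqP <-]; rewrite aE //.
  exact/lexpos_neq0/(allP vs_pos).
(* An empty class gets the base point as its tip. Otherwise the tip lies on the segment from [z] to
   the corner [z + a j *+ m j], hence in [s]. *)
pose tip j := if m j == 0%N then z else z + a j.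
have tip_s j : tip j \in s.
  rewrite /tip; case: eqP => // /eqP; rewrite -lt0n => mj.
  by rewrite -[a j]mulr1n; apply: s_closed (am_s j).
pose d (i : cert_index) := match i with
  | inl (inl None) => index z s
  | inl (inl (Some j)) => index (tip j) s
  | inl (inr j) => m j
  | inr A => index (z + \sum_(j in A) a j *+ m j) s
  end.
exists d; split.
- case=> [[[j|]|j]|A] /=; rewrite ?index_mem //.
  have [->|] := posnP (m j).
    by move: zs; rewrite -index_mem => /(leq_ltn_trans (leq0n _)).
  by move=> mj; apply: (progression_lt_size (a_neq0 j mj) zs).
- move=> A; rewrite /cert_point /= !nth_index //; congr (_ + _).
  apply: eq_bigr => j _; rewrite nth_index // /tip.
  by case: eqP => [->|_]; rewrite ?mulr0n // [z + a j]addrC addrK.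
- rewrite /cert_value -sum1_size (partition_big parity predT) //=.
  apply: eq_bigr => j _; rewrite sum1_count -/(m j) /=.
  have [->|mj] := posnP (m j); first by rewrite mul0n.
  suff -> : index (tip j) s != index z s by rewrite muln1.
  apply: contra (a_neq0 j mj) => /eqP/(congr1 (nth 0 s)).
  rewrite !nth_index // /tip gtn_eqF // => /(canRL (addKr z)) ->.
  by rewrite addNr.
Qed.

(** Validity and the bound on positions put all corners in [s], and the corner criterion then gives
    all subset sums. *)
Lemma cert_decomposition d :
  (forall i, d i < size s)%N -> cert_valid d ->
  exists z vs, [/\ size vs = cert_value d, all (fun v => v != 0) vs
                 & subset_sums_in (fun x => x \in s) z vs].
Proof.
move=> d_lt d_valid.
pose z := cert_point d (point_of None).
pose a j := cert_point d (point_of (Some j)) - z.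
pose m j := (d (mult_of j) *
  (d (point_of (Some j)) != d (point_of None)))%N.
have point_s i : cert_point d i \in s by apply: mem_nth.
(* [m] drops the multiplicities of zero vectors, which leaves the corners unchanged. *)
have amE j : a j *+ m j = a j *+ d (mult_of j).
  rewrite /m /a /z /cert_point; case: eqP => [->|_]; last by rewrite muln1.
  by rewrite subrr !mul0rn.
exists z, (flatten [seq nseq (m j) (a j) | j <- enum {: J}]); split.
- rewrite size_flatten /shape -map_comp sumnE big_map big_enum /=.
  by apply: eq_bigr => j _; rewrite size_nseq.
- apply/allP => v /flatten_mapP[j _]; rewrite mem_nseq => /andP[mj /eqP ->].
  rewrite subr_eq0 /z /cert_point nth_uniq //.
  by move: mj; rewrite /m; case: (_ != _); rewrite // muln0.
- apply: subset_sums_in_blocks => // b.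
  have := point_s (corner_of [set j in mask b (enum {: J})]).
  rewrite d_valid; congr (_ + _ \in s).
  rewrite big_uniq ?mask_uniq ?enum_uniq //=.
  by apply: eq_big => j; rewrite ?inE // amE.
Qed.

End Certificates.

(** * Full Minkowski length as the largest number of segments in a sum inside the polygon *)

Section MinkowskiLength.
Variable R : realType.
Implicit Types (C P Q : set 'rV[R]_2) (Qs : seq (set 'rV[R]_2)).
Implicit Types (z v : 'rV[int]_2) (vs : seq 'rV[int]_2).
Local Open Scope classical_set_scope.
Local Notation lp := (@lattice_point R).
Local Notation msum := (@minkowski_sum R).

Lemma convex_setP C :
  convex_set C <->
  (forall x y (t : R), 0 <= t <= 1 -> C x -> C y -> C (t *: x + (1 - t) *: y)).
Proof.
split=> [cC x y t /andP[t0 t1] Cx Cy|cC x y t].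
  have := cC x y (Itv01 t0 t1); rewrite !inE; exact.
rewrite !inE => Cx Cy; apply: cC => //.
by apply/andP; split.
Qed.

Lemma convex_set_comb C x y (t : R) :
  convex_set C -> 0 <= t <= 1 -> C x -> C y -> C (t *: x + (1 - t) *: y).
Proof. by move/convex_setP; apply. Qed.

Lemma convex_hull_convex (A : set 'rV[R]_2) : convex_set (convex_hull A).
Proof.
apply/convex_setP => x y t t01 hx hy C [cC AC].
by move/convex_setP: (cC); apply=> //; [apply: hx|apply: hy].
Qed.

Lemma lattice_polytope_convex P : lattice_polytope P -> convex_set P.
Proof. by move=> [A [_ _ ->]]; apply: convex_hull_convex. Qed.

Lemma convex_hull1 (x : 'rV[R]_2) : convex_hull [set x] = [set x].
Proof.
apply: smallest_id; apply/convex_setP => _ _ t _ -> ->.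
by rewrite -scalerDl addrC subrK scale1r.
Qed.

Lemma lattice_pointD z v : lp (z + v) = lp z + lp v.
Proof. exact: map_mxD. Qed.

Lemma lattice_pointMn z n : lp (z *+ n) = lp z *+ n.
Proof.
elim: n => [|n IH]; first exact: map_mx0.
by rewrite !mulrS lattice_pointD IH.
Qed.

Lemma lattice_point_inj : injective lp.
Proof.
move=> u v /matrixP uv; apply/matrixP => i j.
by apply: (@intr_inj R); have := uv i j; rewrite !mxE.
Qed.

Lemma lattice_segment_closed C :
  convex_set C -> segment_closed (fun x => C (lp x)).
Proof.
move=> /convex_setP cC x a m k km Cx Cxm.
have [m0|m_gt0] := posnP m.
  by move: km; rewrite m0 leqn0 => /eqP ->; rewrite addr0.
have m_neq0 : m%:R != 0 :> R by rewrite pnatr_eq0 -lt0n.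
(* The point [x + a *+ k] divides the segment from [x] to [x + a *+ m] in the ratio given by the
   weight [k / m]. *)
have := cC _ _ (k%:R / m%:R) _ Cxm Cx; rewrite !lattice_pointD !lattice_pointMn.
rewrite scalerDr addrAC -scalerDl [_ / _ + _]addrC subrK scale1r.
rewrite -[lp a *+ m]scaler_nat scalerA divfK // scaler_nat; apply.
by rewrite divr_ge0 ?ler0n //= ler_pdivrMr ?ltr0n // mul1r ler_nat.
Qed.

Lemma lattice_polytope1 z : lattice_polytope [set lp z].
Proof.
exists [set z]; split; [exact: finite_set1 | by exists z|].
by rewrite image_set1 convex_hull1.
Qed.

(** The sum of the hulls of [A] and [B] is the hull of [A + B]: it is convex and contains [A + B],
    and conversely each summand can be reduced to its generators in turn. *)
Lemma lattice_polytopeD P Q :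
  lattice_polytope P -> lattice_polytope Q -> lattice_polytope (msum P Q).
Proof.
move=> [A [finA [a Aa] ->]] [B [finB [b Bb] ->]].
exists [set x + y | x in A & y in B]; split.
- exact: finite_image2.
- by exists (a + b), a => //; exists b.
pose AB := lp @` [set x + y | x in A & y in B]; rewrite -/AB.
have [cA cB cAB] : [/\ convex_set (convex_hull (lp @` A)),
    convex_set (convex_hull (lp @` B)) & convex_set (convex_hull AB)].
  by split; apply: convex_hull_convex.
apply/seteqP; split; last first.
  apply: smallest_sub.
    apply/convex_setP => _ _ t t01 [x1 hx1 [y1 hy1 <-]] [x2 hx2 [y2 hy2 <-]].
    exists (t *: x1 + (1 - t) *: x2).
      exact: (convex_set_comb cA).
    exists (t *: y1 + (1 - t) *: y2).
      exact: (convex_set_comb cB).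
    by rewrite !scalerDr addrACA.
  move=> _ [_ [x Ax [y By <-]] <-]; rewrite lattice_pointD.
  exists (lp x); first by apply: sub_gen_smallest; exists x.
  by exists (lp y) => //; apply: sub_gen_smallest; exists y.
move=> _ [x hx [y hy <-]].
have tconv (u v w : 'rV[R]_2) t :
    t *: u + (1 - t) *: v + w = t *: (u + w) + (1 - t) *: (v + w).
  by rewrite !scalerDr addrACA -scalerDl [t + _]addrC subrK scale1r.
(* For fixed [y], the [x] with [x + y] in the hull of [A + B] form a convex set, so only generators
   [x] matter; then the same for [y]. *)
move: x hx; apply: smallest_sub.
  apply/convex_setP => u v t t01 hu hv; rewrite /= tconv.
  exact: (convex_set_comb cAB).
move=> _ [x Ax <-]; move: y hy; apply: smallest_sub.
  apply/convex_setP => u v t t01 hu hv; rewrite addrC tconv ![_ + lp x]addrC.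
  exact: (convex_set_comb cAB).
move=> _ [y By <-]; rewrite /= -lattice_pointD; apply: sub_gen_smallest.
by exists (x + y) => //; exists x => //; exists y.
Qed.

Lemma lattice_polytope_nonempty P : lattice_polytope P -> exists z, P (lp z).
Proof.
by move=> [A [_ [z Az] ->]]; exists z; apply: sub_gen_smallest; exists z.
Qed.

(** With a single generator the hull would be a point. *)
Lemma positive_dim_lattice P :
  lattice_polytope P -> positive_dim P ->
  exists u w, [/\ P (lp u), P (lp w) & u != w].
Proof.
move=> [A [_ [u Au] PE]] [x [y [Px Py xy]]].
have AP w : A w -> P (lp w).
  by move=> Aw; rewrite PE; apply: sub_gen_smallest; exists w.
have [[w Aw uw]|none] := pselect (exists2 w, A w & u != w).
  by exists u, w; split=> //; apply: AP.
suff Pu : P = [set lp u] by move: Px Py xy; rewrite Pu => -> ->.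
rewrite PE (_ : A = [set u]) ?image_set1 ?convex_hull1 //.
apply/seteqP; split=> [w Aw|w -> //].
by apply/esym/eqP/negP => /negP uw; apply: none; exists w.
Qed.

Definition summands Qs : Prop := forall i, (i < size Qs)%N ->
  lattice_polytope (nth set0 Qs i) /\ positive_dim (nth set0 Qs i).

Lemma summands_cons Q Qs :
  summands (Q :: Qs) <-> (lattice_polytope Q /\ positive_dim Q) /\ summands Qs.
Proof.
split=> [h|[hQ hQs] [|i]//]; last exact: hQs.
by split=> [|i]; [apply: (h 0%N)|apply: (h i.+1)].
Qed.

Lemma summands_polytope Qs :
  summands Qs -> lattice_polytope (foldr msum [set 0] Qs).
Proof.
elim: Qs => [_|Q Qs IH /summands_cons[[Qp _] /IH]] /=.
  by rewrite -(map_mx0 intr); apply: lattice_polytope1.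
exact: lattice_polytopeD.
Qed.

Lemma summands_positive_dim Qs :
  summands Qs -> (0 < size Qs)%N -> positive_dim (foldr msum [set 0] Qs).
Proof.
case: Qs => // Q Qs /summands_cons[[_ [x [y [Qx Qy xy]]]] /summands_polytope].
move=> /lattice_polytope_nonempty[z Qz] _; exists (x + lp z), (y + lp z); split.
- by exists x => //; exists (lp z).
- by exists y => //; exists (lp z).
- by move/addIr.
Qed.

Definition zonotope_length P k : Prop := exists z vs,
  [/\ size vs = k, all (fun v => v != 0) vs
    & subset_sums_in (fun x => P (lp x)) z vs].

(** Two distinct lattice points [u], [w] of each summand give the vector [w - u]; the base point is
    the sum of the chosen [u]. *)
Lemma summands_zonotope Qs :
  summands Qs -> zonotope_length (foldr msum [set 0] Qs) (size Qs).
Proof.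
elim: Qs => [_|Q Qs IH /summands_cons[[Qp Qd] /IH]] /=.
  by exists 0, [::]; split=> //=; apply: map_mx0.
move=> [z [vs [<- vs0 hz]]].
have [u [w [Qu Qw uw]]] := positive_dim_lattice Qp Qd.
exists (u + z), (w - u :: vs); split=> //=; first by rewrite subr_eq0 eq_sym uw.
rewrite addrAC subrKC; split;
  apply: subset_sums_in_shift hz => x hx; rewrite lattice_pointD.
  by exists (lp u) => //; exists (lp x).
by exists (lp w) => //; exists (lp x).
Qed.

Definition lattice_segment z v := convex_hull (lp @` [set z; z + v]).

Lemma lattice_segmentP z v x :
  lattice_segment z v x -> exists2 t : R, 0 <= t <= 1 & x = lp z + t *: lp v.
Proof.
move: x; apply: smallest_sub => [|x].
  apply/convex_setP => _ _ t /andP[t0 t1]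
    [p /andP[p0 p1] ->] [q /andP[q0 q1] ->].
  exists (t * p + (1 - t) * q); first by nra.
  rewrite !scalerDr addrACA -scalerDl [t + _]addrC subrK scale1r.
  by rewrite !scalerA -scalerDl.
move=> [_ [->|->] <-]; first by exists 0; rewrite ?lexx ?ler01 // scale0r addr0.
by exists 1; rewrite ?lexx ?ler01 // scale1r lattice_pointD.
Qed.

Lemma lattice_segment_polytope z v : v != 0 ->
  lattice_polytope (lattice_segment z v) /\ positive_dim (lattice_segment z v).
Proof.
move=> v0; split.
  by exists [set z; z + v]; split=> //; exists z; left.
exists (lp z), (lp (z + v)); split.
- by apply: sub_gen_smallest; exists z => //; left.
- by apply: sub_gen_smallest; exists (z + v) => //; right.
- move/lattice_point_inj/eqP; rewrite -{1}[z]addr0 (inj_eq (addrI z)) eq_sym.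
  exact/negP.
Qed.

Lemma lattice_segments_summands vs :
  all (fun v => v != 0) vs -> summands (map (lattice_segment 0) vs).
Proof.
elim: vs => //= v vs IH /andP[v0 /IH h].
by apply/summands_cons; split=> //; apply: lattice_segment_polytope.
Qed.

Lemma convex_between C x y (t : R) :
  convex_set C -> 0 <= t <= 1 -> C x -> C (x + y) -> C (x + t *: y).
Proof.
move=> cC t01 Cx Cxy; have := convex_set_comb cC t01 Cxy Cx.
by rewrite scalerDr addrAC -scalerDl [t + _]addrC subrK scale1r.
Qed.

(** One segment is peeled off at a time: the point lies between two points that the induction
    hypothesis, at base points [z] and [z + v], puts in [C]. *)
Lemma lattice_segments_sub C z vs x :
  convex_set C -> subset_sums_in (fun y => C (lp y)) z vs ->
  foldr msum [set 0] (map (lattice_segment 0) vs) x -> C (lp z + x).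
Proof.
move=> cC; elim: vs z x => [|v vs IH] z x /=.
  by move=> ? ->; rewrite addr0.
move=> [h0 h1] [p /lattice_segmentP[t t01 ->] [q hq <-]].
rewrite [lp 0](map_mx0 intr) add0r addrCA addrC.
apply: convex_between => //; first exact: IH.
by rewrite addrAC -lattice_pointD; apply: IH.
Qed.

(** The first segment starts at [z] and so absorbs the translation; this is why at least one vector
    is required. *)
Lemma zonotope_length_decomposition P k :
  convex_set P -> zonotope_length P k.+1 ->
  exists Qs, [/\ summands Qs, size Qs = k.+1 & foldr msum [set 0] Qs `<=` P].
Proof.
move=> cP [z [[|v vs] [//= [sz] /andP[v0 vs0] [h0 h1]]]].
exists (lattice_segment z v :: map (lattice_segment 0) vs); split.
- apply/summands_cons; split; first exact: lattice_segment_polytope.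
  exact: lattice_segments_summands.
- by rewrite /= size_map sz.
move=> _ [p /lattice_segmentP[t t01 ->] [q hq <-]].
rewrite addrAC; apply: convex_between => //.
  exact: lattice_segments_sub hq.
by rewrite addrAC -lattice_pointD; apply: lattice_segments_sub hq.
Qed.

Lemma zonotope_length_sub P Q k :
  Q `<=` P -> zonotope_length Q k -> zonotope_length P k.
Proof.
move=> QP [z [vs [sz vs0 h]]]; exists z, vs; split=> //.
by apply: subset_sums_in_sub h => x; apply: QP.
Qed.

Lemma full_minkowski_length_zonotope P L :
  convex_set P -> is_max (zonotope_length P) L -> is_full_minkowski_length P L.
Proof.
move=> cP [PL maxL].
have bound Q k : Q `<=` P ->
    (exists2 Qs, minkowski_decomposition Q Qs & size Qs = k) -> (k <= L)%N.
  move=> QP [Qs [hQs QE] <-]; apply/maxL/(zonotope_length_sub QP).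
  by rewrite QE; apply: summands_zonotope.
split=> [|l [Q [_ QP [Ql Q0]]]]; last first.
  have [Qd|/Q0 -> //] := pselect (positive_dim Q).
  exact/bound/(Ql Qd).1.
(* For [L = 0] no segment can carry the base point, and a single lattice point of [P] is the
   witness. *)
case: L PL maxL bound => [|L] PL maxL bound.
  case: PL => z [[|? ?] [//= _ _ Pz]]; exists [set lp z]; split.
  - exact: lattice_polytope1.
  - by move=> _ ->.
  - by split=> // -[x [y [-> ->]]].
have [Qs [hQs szQs QsP]] := zonotope_length_decomposition cP PL.
exists (foldr msum [set 0] Qs); split=> //; first exact: summands_polytope.
split=> [_|[]]; last by apply: summands_positive_dim => //; rewrite szQs.
by split=> [|k]; [exists Qs|apply: bound].
Qed.

End MinkowskiLength.

(** * Loop rule, digits and evaluation of expressions *)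

Section Execution.

(** Total correctness with a time bound: the invariant is indexed by the number of completed
    iterations, and [C] bounds the cost of each of them. *)
Lemma exec_while (e : expr) (c : program) (I : nat -> state -> Prop)
    (N C : nat) :
  (forall k st, (k < N)%N -> I k st -> eval st e != 0 /\
     exists t st', [/\ exec c st t st', (t <= C)%N & I k.+1 st']) ->
  (forall st, I N st -> eval st e = 0) ->
  forall k st, (k <= N)%N -> I k st -> exists t st',
    [/\ exec (While e c) st t st',
        (t <= (N - k) * (cost e + C).+1 + (cost e).+1)%N & I N st'].
Proof.
move=> step stop k st /subnK; move: (N - k)%N => m.
elim: m k st => [|m IH] k st.
  rewrite add0n => -> Ist; exists (cost e).+1, st; split=> //.
  exact/exec_while_false/stop.
rewrite addSnnS => mk Ist.
have [|e_neq0 [t [st1 [run1 tC Ist1]]]] := step k st _ Ist; first by lia.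
have [t' [st2 [run2 t'C Ist2]]] := IH _ _ mk Ist1.
exists (cost e + t + t').+1, st2; split=> //.
  exact: exec_while_true run1 run2.
by rewrite mulSn; lia.
Qed.

(** Built from the lowest digit: [K * n + f 0], where [K] encodes the shifted sequence. *)
Lemma digits_exist n D (f : nat -> nat) : (forall i, f i < n)%N ->
  exists2 K, (K < n ^ D)%N & forall i, (i < D)%N -> (K %/ n ^ i %% n)%N = f i.
Proof.
move=> f_lt; have n_gt0 : (0 < n)%N by apply: leq_ltn_trans (f_lt 0%N).
elim: D f f_lt => [|D IH] f f_lt; first by exists 0%N; rewrite ?expn0.
have [|K K_lt KE] := IH (f \o succn); first by move=> i; apply: f_lt.
exists (K * n + f 0)%N => [|[|i] iD].
- rewrite expnS mulnC; have := f_lt 0%N; nia.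
- by rewrite expn0 divn1 modnMDl modn_small.
- by rewrite expnS divnMA divnMDl // (divn_small (f_lt _)) addn0 KE.
Qed.

Definition sum_expr (es : seq expr) : expr := foldr (Binop OpAdd) (Const 0) es.

Definition prod_expr (es : seq expr) : expr := foldr (Binop OpMul) (Const 1) es.

Lemma eval_add st e1 e2 :
  eval st (Binop OpAdd e1 e2) = eval st e1 + eval st e2.
Proof. by []. Qed.

Lemma eval_le st e1 e2 :
  (eval st (Binop OpLe e1 e2) != 0) = (eval st e1 <= eval st e2).
Proof. by rewrite /=; case: (eval st e1 <= _). Qed.

Lemma eval_sum st es : eval st (sum_expr es) = \sum_(e <- es) eval st e.
Proof. by elim: es => [|e es IH] /=; rewrite ?big_nil // big_cons IH. Qed.

Lemma eval_prod st es : eval st (prod_expr es) = \prod_(e <- es) eval st e.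
Proof. by elim: es => [|e es IH] /=; rewrite ?big_nil // big_cons IH. Qed.

Lemma eval_eq st e1 e2 :
  (eval st (Binop OpEq e1 e2) != 0) = (eval st e1 == eval st e2).
Proof. by rewrite /=; case: (eval st e1 == _). Qed.

End Execution.

(** * The exhaustive search, its invariant and its cost *)

Section SearchProgram.
Local Notation J := (bool * bool)%type.

(* Register 0 holds the number of points, register 1 the current guess and
   register 2 the largest value found so far. *)
Definition size_pow (k : nat) : expr := prod_expr (nseq k (Reg 0)).

Definition search_bound : expr := size_pow #|cert_index|.

(** The exponent [enum_rank i] belongs to the program text and not to the input, so the expression
    has constant cost. *)
Definition digit (i : cert_index) : expr :=
  Binop OpMod (Binop OpDiv (Reg 1) (size_pow (enum_rank i))) (Reg 0).

Definition coord (c : 'I_2) (i : cert_index) : expr :=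
  Fetch (Binop OpAdd (Binop OpMul (Const 2) (digit i)) (Const (c : nat))).

Definition corner_test (c : 'I_2) (A : {set J}) : expr :=
  Binop OpEq (coord c (corner_of A))
    (Binop OpAdd (coord c (point_of None))
      (sum_expr [seq Binop OpMul (digit (mult_of j))
                   (Binop OpSub (coord c (point_of (Some j)))
                      (coord c (point_of None))) | j <- enum A])).

(** The product serves as a conjunction of tests with values 0 and 1. *)
Definition valid_test : expr :=
  prod_expr [seq corner_test cA.1 cA.2 | cA <- enum {: 'I_2 * {set J}}].

Definition value_expr : expr :=
  sum_expr [seq Binop OpMul (digit (mult_of j))
              (Binop OpSub (Const 1)
                 (Binop OpEq (digit (point_of (Some j)))
                    (digit (point_of None)))) | j <- enum {: J}].

Definition search_body : program :=
  Seq (If valid_test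
         (If (Binop OpLe (Reg 2) value_expr) (Assign 2 value_expr) Skip) Skip)
      (Assign 1 (Binop OpAdd (Reg 1) (Const 1))).

(** The strict comparison of the counter with the bound, expressed through [OpLe]. *)
Definition search_test : expr :=
  Binop OpLe (Binop OpAdd (Reg 1) (Const 1)) search_bound.

Definition search_program : program :=
  Seq (While search_test search_body) (Assign 0 (Reg 2)).

(** The value is evaluated up to twice, for the comparison and for the assignment. *)
Definition body_cost : nat := cost valid_test + (cost value_expr).*2 + 10.

Variable s : seq 'rV[int]_2.
Local Notation n := (size s).

Definition decode (K : nat) (i : cert_index) : nat :=
  K %/ n ^ enum_rank i %% n.

Lemma decode_lt K i : (0 < n)%N -> (decode K i < n)%N.
Proof. exact: ltn_pmod. Qed.

Lemma decode_surj (d : cert_index -> nat) : (forall i, d i < n)%N ->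
  exists2 K, (K < n ^ #|cert_index|)%N & decode K =1 d.
Proof.
move=> d_lt.
(* Beyond the ranks of indices the digit is 0, which is below [n] because some [d i] is. *)
pose f k := if insub k is Some i then d (@enum_val cert_index predT i) else 0%N.
have f_lt k : (f k < n)%N.
  rewrite /f; case: insubP => [i _ _|_]; first exact: d_lt.
  exact: leq_ltn_trans (d_lt (point_of None)).
have [K K_lt KE] := digits_exist #|cert_index| f_lt.
by exists K => // i; rewrite /decode KE // /f valK enum_rankK.
Qed.

(** An empty maximum is 0, in agreement with the initial content of register 2. *)
Definition best (K : nat) : nat :=
  \max_(k < K | `[< cert_valid s (decode k) >]) cert_value (decode k).

Definition search_invariant (K : nat) (st : state) : Prop :=
  [/\ regs st 0%N = n%:Z, regs st 1%N = K%:Z, regs st 2%N = (best K)%:Z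
    & memory st = memory (input_state s)].

Lemma memory_input (i : nat) (c : 'I_2) :
  (i < n)%N -> memory (input_state s) (2 * i + c)%N%:Z = nth 0 s i 0 c.
Proof.
change ((i < n)%N ->
  nth 0 (flatten [seq [:: z 0 0; z 0 1] | z : 'rV[int]_2 <- s]) (2 * i + c) =
  nth 0 s i 0 c).
elim: s i => [//|z r IH] [_|i i_lt].
  by case: c {IH} => [[|[|//]] ?] /=; congr (z 0 _); apply: val_inj.
have -> : (2 * i.+1 + c = (2 * i + c).+2)%N by lia.
exact: IH.
Qed.

Lemma eval_size_pow st k :
  regs st 0%N = n%:Z -> eval st (size_pow k) = (n ^ k)%N%:Z.
Proof.
move=> st0; rewrite eval_prod big_nseq /=.
by elim: k => //= k ->; rewrite st0 expnS PoszM.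
Qed.

Section Step.
Variables (K : nat) (st : state).
Hypotheses (n_gt0 : (0 < n)%N) (inv : search_invariant K st).

Lemma eval_digit i : eval st (digit i) = (decode K i)%:Z.
Proof.
have [st0 st1 _ _] := inv.
by rewrite [LHS]/= eval_size_pow // st0 st1 divz_nat modz_nat.
Qed.

Lemma eval_coord c i : eval st (coord c i) = cert_point s (decode K) i 0 c.
Proof.
have [_ _ _ mem] := inv; rewrite -memory_input ?decode_lt // -mem.
by rewrite PoszD PoszM -eval_digit.
Qed.

Lemma eval_corner_test c A :
  (eval st (corner_test c A) != 0) =
  (cert_point s (decode K) (corner_of A) 0 c ==
   (cert_point s (decode K) (point_of None) + \sum_(j in A)
      (cert_point s (decode K) (point_of (Some j)) -
       cert_point s (decode K) (point_of None)) *+ decode K (mult_of j)) 0 c).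
Proof.
rewrite eval_eq eval_coord !mxE; congr (_ == _).
rewrite eval_add eval_coord eval_sum big_map big_enum summxE; congr (_ + _).
apply: eq_bigr => j _; rewrite mulmxnE !mxE -!eval_coord.
by rewrite -mulr_natl natz -eval_digit.
Qed.

Lemma eval_valid_test :
  (eval st valid_test != 0) = `[< cert_valid s (decode K) >].
Proof.
rewrite eval_prod big_map prodf_seq_neq0.
apply/allP/asboolP => [h A|h [c A] _].
  apply/rowP => c; have := h (c, A) (mem_enum _ _).
  by rewrite /= eval_corner_test => /eqP.
by rewrite /= eval_corner_test -h.
Qed.

Lemma eval_value_expr : eval st value_expr = (cert_value (decode K))%:Z.
Proof.
rewrite eval_sum big_map big_enum /= /cert_value (big_morph Posz PoszD erefl).
apply: eq_bigr => j _.
have distinctE e1 e2 : eval st (Binop OpSub (Const 1) (Binop OpEq e1 e2)) =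
    (nat_of_bool (eval st e1 != eval st e2))%:Z.
  by rewrite /=; case: (eval st e1 == _).
by rewrite PoszM -eqz_nat -!eval_digit -distinctE.
Qed.

End Step.

Lemma best_succ K : best K.+1 =
  if `[< cert_valid s (decode K) >] then maxn (best K) (cert_value (decode K))
  else best K.
Proof.
rewrite /best big_mkcond big_ord_recr -big_mkcond /=.
by case: ifP; rewrite // maxn0.
Qed.

Lemma search_body_step K st : (0 < n)%N -> search_invariant K st ->
  exists t st', [/\ exec search_body st t st', (t <= body_cost)%N
                  & search_invariant K.+1 st'].
Proof.
move=> n_gt0 inv; have [st0 st1 st2 mem] := inv.
have validE := eval_valid_test n_gt0 inv; have valueE := eval_value_expr inv.
have [t [st' [run t_le [st'0 st'1 st'2 mem']]]] : exists t st',
    [/\ exec (If valid_test (If (Binop OpLe (Reg 2) value_expr)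
                 (Assign 2 value_expr) Skip) Skip) st t st',
        (t <= cost valid_test + (cost value_expr).*2 + 5)%N
      & [/\ regs st' 0%N = n%:Z, regs st' 1%N = K%:Z,
            regs st' 2%N = (best K.+1)%:Z & memory st' = memory st]].
  rewrite best_succ -validE; case: eqVneq => [valid0|valid1].
    exists (cost valid_test + 1).+1, st; split=> //; last by lia.
    exact: exec_if_false (exec_skip _).
  have leE : (eval st (Binop OpLe (Reg 2) value_expr) != 0) =
      (best K <= cert_value (decode K))%N.
    by rewrite eval_le /= st2 valueE lez_nat.
  have [le_best|lt_best] := leqP (best K) (cert_value (decode K)).
    exists (cost valid_test +
      (cost (Binop OpLe (Reg 2) value_expr) + (cost value_expr).+1).+1).+1,
      (State (update (regs st) 2%N (eval st value_expr)) (memory st)).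
    split; last by split=> //=; rewrite /update /= valueE.
      apply: exec_if_true => //; apply: exec_if_true; last exact: exec_assign.
      by rewrite leE.
    by rewrite /=; lia.
  exists (cost valid_test +
      (cost (Binop OpLe (Reg 2) value_expr) + 1).+1).+1, st.
  split=> //; last by rewrite /=; lia.
  apply: exec_if_true => //; apply: exec_if_false; last exact: exec_skip.
  by apply/eqP/negbNE; rewrite leE -ltnNge.
exists (t + 4)%N,
  (State (update (regs st') 1%N (regs st' 1%N + 1)) (memory st')).
split; last by split; rewrite /= /update //= ?mem' // st'1 -PoszD addn1.
  by apply: exec_seq run _; apply: exec_assign.
by rewrite /body_cost; lia.
Qed.

Lemma search_program_run : (0 < n)%N -> exists2 t,
  outputs_in search_program s t (best (n ^ #|cert_index|))
  & (t <= n ^ #|cert_index| * (cost search_test + body_cost).+1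
          + (cost search_test + 3))%N.
Proof.
move=> n_gt0; set N := (n ^ _)%N.
have testE K st : search_invariant K st ->
    (eval st search_test != 0) = (K < N)%N.
  move=> [st0 st1 _ _].
  by rewrite eval_le eval_size_pow // eval_add /= st1 -PoszD lez_nat addn1.
have [|||t [st [run t_le [_ _ st2 _]]]] :=
  @exec_while search_test search_body search_invariant N body_cost _ _ 0%N
    (input_state s) (leq0n _).
- move=> K st K_lt inv; split; first by rewrite (testE _ _ inv) K_lt.
  exact: search_body_step.
- by move=> st /testE; rewrite ltnn => /negbFE/eqP.
- by split=> //=; rewrite /best big_ord0.
exists (t + 2)%N; last by move: t_le; rewrite subn0; lia.
exists (State (update (regs st) 0%N (regs st 2%N)) (memory st)).
  by apply: exec_seq run _; apply: exec_assign.
by rewrite /= /update /= st2.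
Qed.

End SearchProgram.

(** * Correctness of the search and the polynomial bound *)

Lemma best_is_max (R : realType) (P : set 'rV[R]_2) (s : seq 'rV[int]_2) :
  lattice_polytope P -> lists_lattice_points P s ->
  is_max (zonotope_length P) (best s (size s ^ #|cert_index|)).
Proof.
move=> Ppoly [s_uniq sP].
have s_closed : segment_closed (fun x => x \in s).
  move=> x a m k km /sP Px /sP Pxm; apply/sP.
  by apply: (lattice_segment_closed (lattice_polytope_convex Ppoly) km).
have cert_length d : (forall i, (d i < size s)%N) -> cert_valid s d ->
    zonotope_length P (cert_value d).
  move=> d_lt d_valid.
  have [z [vs [sz vs0 h]]] := cert_decomposition s_uniq s_closed d_lt d_valid.
  by exists z, vs; split=> //; apply: subset_sums_in_sub h => x /sP.
have code l : zonotope_length P l -> exists K : 'I_(size s ^ #|cert_index|),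
    cert_valid s (decode s K) /\ cert_value (decode s K) = l.
  move=> [z [vs [<- vs0 h]]].
  have {}h : subset_sums_in (fun x => x \in s) z vs.
    by apply: subset_sums_in_sub h => x /sP.
  have [d [d_lt d_valid <-]] := cert_exists s_closed vs0 h.
  have [K K_lt KE] := decode_surj d_lt.
  by exists (Ordinal K_lt); rewrite /= (funext KE).
have [z Pz] := lattice_polytope_nonempty Ppoly.
have n_gt0 : (0 < size s)%N by move/sP: Pz; case: (s).
(* The empty family at [z] yields a valid guess, so the maximum is attained by a certificate and is
   not merely the default 0. *)
have [|K0 [K0_valid _]] := code 0%N; first by exists z, [::].
split; last first.
  move=> l /code[K [K_valid <-]]; apply: (leq_bigmax_cond K); exact/asboolP.
pose valid (K : 'I_(size s ^ #|cert_index|)) :=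
  `[< cert_valid s (decode s K) >].
have [|K K_valid bestE] := @eq_bigmax_cond _ valid
    (fun K : 'I_(size s ^ #|cert_index|) => cert_value (decode s K)).
  by apply/card_gt0P; exists K0; apply/asboolP.
rewrite /best bestE; apply: cert_length; last exact/asboolP.
by move=> i; apply: decode_lt.
Qed.

Theorem theorem3p2 (R : realType) :
  exists (c : program) (p : {poly nat}),
    forall (P : set 'rV[R]_2) (s : seq 'rV[int]_2),
      lattice_polytope P -> lists_lattice_points P s ->
      exists L t : nat,
        [/\ is_full_minkowski_length P L,
            outputs_in c s t L
          & (t <= p.[size s])%N].
Proof.
exists search_program.
(* The degree is the number of digits, 5 + 4 + 16 = 25. The coefficient bounds one iteration, and
   the constant term pays for the last test and the copy to register 0. *)
exists ((cost search_test + body_cost).+1%:P * 'X^#|cert_index|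
        + (cost search_test + 3)%:P).
move=> P s Ppoly sP.
have s_gt0 : (0 < size s)%N.
  have [z /(sP.2 z)] := lattice_polytope_nonempty Ppoly.
  by case: (s).
have [t run t_le] := search_program_run s_gt0.
exists (best s (size s ^ #|cert_index|)), t; split=> //.
  apply: full_minkowski_length_zonotope; first exact: lattice_polytope_convex.
  exact: best_is_max.
by rewrite hornerD hornerM hornerXn !hornerC natrXE mulrC.
Qed.
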